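(* Let $\mathcal{G}=(V,E,W)$ be a directed weighted graph with $n$ nodes, let $L_{adv}=D_{out}-A_{in}$ be its graph advection operator and $L_{cons}=D_{in}-A_{in}$ its consensus operator. Write the graph advection equation $\frac{du(t)}{dt}=-L_{adv}u(t)$ in the form of a semi-discrete finite difference scheme $$\frac{du_i(t)}{dt}=\sum_{j\neq i}c_{ij}\,u_j(t)+c_{ii}\,u_i(t),\qquad i=1,\dots,n,$$ with coefficients $c_{ij}=-(L_{adv})_{ij}\in\mathbb{R}$. Then $L_{adv}$ corresponds to a semi-discrete finite difference advection scheme in which the sum of the coefficients is zero, i.e. $c_{ii}=-\sum_{j\neq i}c_{ij}$ for every node $i$, if and only if the graph $\mathcal{G}$ is balanced, i.e. $L_{adv}=L_{cons}$.
   Context: $\mathcal{G}=(V,E,W)$ is a directed weighted graph with $V=\{1,\dots,n\}$ the node set, $E$ the set of directed edges, and $W$ the set of real edge weights; the edge $(i,j)\in E$ is directed from node $i$ to node $j$ and has weight $w_{ji}\in W$. A function on the nodes at time $t$ is a vector $u(t)=(u_1(t),\dots,u_n(t))$, where $u_i(t)$ is the concentration at node $i$. The in-degree adjacency matrix $A_{in}$ is the $n\times n$ matrix with $(A_{in})_{ij}=w_{ij}$ if $(j,i)\in E$ and $0$ otherwise. The out-degree matrix $D_{out}$ and the in-degree matrix $D_{in}$ are the diagonal matrices with $$(D_{out})_{ii}=\sum_{j:(i,j)\in E}w_{ji},\qquad (D_{in})_{ii}=\sum_{j:(j,i)\in E}w_{ij}.$$ The graph advection operator is $L_{adv}=D_{out}-A_{in}$,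 so that $$\frac{du_i(t)}{dt}=\sum_{j:(j,i)\in E}w_{ij}u_j(t)-\sum_{j:(i,j)\in E}w_{ji}u_i(t)=-[L_{adv}u(t)]_i.$$ The consensus (diffusion) operator is $L_{cons}=D_{in}-A_{in}$. The graph $\mathcal{G}$ is called balanced if at every node the total weight of outgoing edges equals the total weight of incoming edges, i.e. $(D_{out})_{ii}=(D_{in})_{ii}$ for all $i$; equivalently $L_{adv}=L_{cons}$. A semi-discrete finite difference advection scheme here means one in which the spatial derivative term at node $i$ is replaced by a linear combination $\sum_{j\neq i}c_{ij}u_j+c_{ii}u_i$ with real coefficients $c_{ij}$, while time is kept continuous. *)

(* Defs.v *)
From HB Require Import structures.
From mathcomp Require Import all_boot all_order all_algebra.
From mathcomp Require Import all_classical all_reals all_analysis.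

Set Implicit Arguments.
Unset Strict Implicit.
Unset Printing Implicit Defensive.

Import Order.TTheory GRing.Theory Num.Theory.
Import numFieldNormedType.Exports.

Local Open Scope ring_scope.

(* The edge (i, j), written [edge G i j], is directed from i to j and has weight
   w_{ji} = [weight G j i] (target first).  Values of [weight] off the edge set
   are never used.  Weights have arbitrary sign, and loops are allowed. *)
Record wdigraph (R : realType) (n : nat) := WDigraph {
  edge : rel 'I_n;
  weight : 'I_n -> 'I_n -> R
}.

Definition A_in (R : realType) (n : nat) (G : wdigraph R n) : 'M[R]_n :=
  \matrix_(i, j) (if edge G j i then weight G i j else 0).

Definition D_out (R : realType) (n : nat) (G : wdigraph R n) : 'M[R]_n :=
  diag_mx (\row_i \sum_(j | edge G i j) weight G j i).

Definition D_in (R : realType) (n : nat) (G : wdigraph R n) : 'M[R]_n :=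
  diag_mx (\row_i \sum_(j | edge G j i) weight G i j).

Definition L_adv (R : realType) (n : nat) (G : wdigraph R n) : 'M[R]_n :=
  D_out G - A_in G.

Definition L_cons (R : realType) (n : nat) (G : wdigraph R n) : 'M[R]_n :=
  D_in G - A_in G.

Definition balanced (R : realType) (n : nat) (G : wdigraph R n) : Prop :=
  forall i, D_out G i i = D_in G i i.

(* du/dt = - L_adv u at the single time t, read componentwise. *)
Definition advection_eq (R : realType) (n : nat) (G : wdigraph R n)
    (u : R -> 'cV[R]_n) (t : R) : Prop :=
  forall i, is_derive t 1 (fun s : R => u s i 0) (- (L_adv G *m u t) i 0).

Definition semi_discrete_scheme (R : realType) (n : nat) (c : 'M[R]_n)
    (u : R -> 'cV[R]_n) (t : R) : Prop :=
  forall i, is_derive t 1 (fun s : R => u s i 0)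
    (\sum_(j | j != i) c i j * u t j 0 + c i i * u t i 0).

Definition zero_sum_coefficients (R : realType) (n : nat) (c : 'M[R]_n) : Prop :=
  forall i, c i i = - \sum_(j | j != i) c i j.

(* Main.v *)
(** The row sums of [A_in] are the in-degrees, so the i-th row sum of [L_adv] is
    the out-degree minus the in-degree of node i.  The coefficients of the scheme
    are the negated entries of [L_adv]; they sum to zero in row i exactly when
    these two degrees agree. *)
Require Import Defs.
From mathcomp Require Import all_boot all_order all_algebra.
From mathcomp Require Import all_classical all_reals all_analysis.
Import GRing.Theory Num.Theory.
Local Open Scope ring_scope.

Lemma sum_diag_mx_row (R : pzSemiRingType) (n : nat) (d : 'rV[R]_n) (i : 'I_n) :
  \sum_j diag_mx d i j = d 0 i.
Proof.
rewrite (bigD1 i) //= mxE eqxx mulr1n big1 ?addr0 // => j ji.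
by rewrite mxE eq_sym (negPf ji) mulr0n.
Qed.

Lemma D_outE (R : realType) (n : nat) (G : wdigraph R n) (i : 'I_n) :
  D_out G i i = \sum_(j | edge G i j) weight G j i.
Proof. by rewrite !mxE eqxx mulr1n. Qed.

Lemma D_inE (R : realType) (n : nat) (G : wdigraph R n) (i : 'I_n) :
  D_in G i i = \sum_(j | edge G j i) weight G i j.
Proof. by rewrite !mxE eqxx mulr1n. Qed.

(** Non-edges contribute 0 to the row, so the full sum collapses to the edges entering [i]; a loop
    at [i] counts once on each side. *)
Lemma sum_A_in_row (R : realType) (n : nat) (G : wdigraph R n) (i : 'I_n) :
  \sum_j A_in G i j = D_in G i i.
Proof. by rewrite D_inE [RHS]big_mkcond; apply: eq_bigr => j _; rewrite mxE. Qed.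

Lemma sum_L_adv_row (R : realType) (n : nat) (G : wdigraph R n) (i : 'I_n) :
  \sum_j L_adv G i j = D_out G i i - D_in G i i.
Proof.
(* Only the subtraction is opened, so that the row sums of [D_out] and [A_in] can be evaluated
   separately. *)
under eq_bigr => j _ do rewrite mxE [X in _ + X]mxE.
by rewrite big_split sumrN sum_A_in_row sum_diag_mx_row D_outE mxE.
Qed.

(** Moving the diagonal term back into the sum gives full row sums, which are additive in the
    matrix. *)
Lemma zero_sum_coefficientsP (R : realType) (n : nat) (c : 'M[R]_n) :
  zero_sum_coefficients c <-> forall i, \sum_j c i j = 0.
Proof.
split=> h i; first by rewrite (bigD1 i) //= h addNr.
by move/eqP: (h i); rewrite (bigD1 i) //= addr_eq0 => /eqP.
Qed.

(** The common term [A_in G] cancels, leaving two diagonal matrices to compare on their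
    diagonals. *)
Lemma balanced_L_adv_L_cons (R : realType) (n : nat) (G : wdigraph R n) :
  balanced G <-> L_adv G = L_cons G.
Proof.
split=> [h | /addIr h i]; last by rewrite h.
congr (_ - _); congr diag_mx; apply/rowP => i.
by rewrite !mxE -D_outE -D_inE.
Qed.

Theorem theorem2p1 (R : realType) (n : nat) (G : wdigraph R n) (c : 'M[R]_n)
    (hc : forall i j : 'I_n, c i j = - L_adv G i j) :
  (forall (u : R -> 'cV[R]_n) (t : R),
     advection_eq G u t <-> semi_discrete_scheme c u t) /\
  (zero_sum_coefficients c <-> balanced G) /\
  (balanced G <-> L_adv G = L_cons G).
Proof.
split; last split; last exact: balanced_L_adv_L_cons.
- move=> u t.
  (* Both equations prescribe a derivative of the same function, so it is enough that the prescribed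
     values coincide. *)
  have rhsE i : \sum_(j | j != i) c i j * u t j 0 + c i i * u t i 0 =
      - (L_adv G *m u t) i 0.
    rewrite mxE -sumrN [RHS](bigD1 i) //= addrC hc mulNr; congr (_ + _).
    by apply: eq_bigr => j _; rewrite hc mulNr.
  by split=> h i; move: (h i); rewrite rhsE.
- have sumcE i : \sum_j c i j = D_in G i i - D_out G i i.
    by under eq_bigr => j _ do rewrite hc; rewrite sumrN sum_L_adv_row opprB.
  rewrite zero_sum_coefficientsP.
  split=> h i; last by rewrite sumcE h subrr.
  by apply/esym/eqP; rewrite -subr_eq0 -sumcE h.
Qed.
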